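(* Let $X_1,\dots,X_n$ be random variables on a probability space $(\Omega,\mathbb{P})$ with values in a finite set $\mathcal{X}=\{t_1,\dots,t_d\}$. Then $$I_{\mathrm{sym}}(X_1,\dots,X_n)=\overline{I}_{\mathrm{sym}}(X_1,\dots,X_n)=-S(X_1,\dots,X_n)+\sum_{i=1}^nS(X_i).$$
   Context: Shannon entropy. For a probability measure $p$ on a finite set $\mathcal{Y}$, $S(p):=-\sum_{y\in\mathcal{Y}}p(y)\log p(y)$ (with $0\log0=0$). $p_{(X_1,\dots,X_n)}$ is the joint distribution on $\mathcal{X}^n$ and $p_{X_i}$ the distribution of $X_i$ on $\mathcal{X}$; $S(X_1,\dots,X_n):=S(p_{(X_1,\dots,X_n)})$ and $S(X_i):=S(p_{X_i})$. Types. For $\mathbf{y}=(y_1,\dots,y_N)\in\mathcal{Y}^N$ the type of $\mathbf{y}$ is the probability measure $\nu_{\mathbf{y}}(t):=\frac1N\#\{j:y_j=t\}$, $t\in\mathcal{Y}$. For a probability measure $p$ on $\mathcal{Y}$ and $\delta>0$, $\Delta(p;N,\delta)$ is the set of $\mathbf{y}\in\mathcal{Y}^N$ with $|\nu_{\mathbf{y}}(t)-p(t)|<\delta$ for all $t\in\mathcal{Y}$. Put $\Delta(X_1,\dots,X_n;N,\delta):=\Delta(p_{(X_1,\dots,X_n)};N,\delta)$, where an $n$-tuple of sequences in $\mathcal{X}^N$ is identified with a sequence of length $N$ in $\mathcal{X}^n$. Permutations. $S_N$ is the group of permutations of $\{1,\dots,N\}$, acting on $\mathcal{X}^N$ by $\sigma(\mathbf{x}):=(x_{\sigma^{-1}(1)},\dots,x_{\sigma^{-1}(N)})$;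 $\gamma_{S_N}$ is the uniform probability measure on $S_N$ and $\gamma_{S_N}^{\otimes n}$ the product measure on $S_N^n$. $\mathcal{X}_\le^N$ is the set of sequences of length $N$ of the form $(t_1,\dots,t_1,t_2,\dots,t_2,\dots,t_d,\dots,t_d)$ (each $t_l$ may occur any number of times, including zero). $\Delta_{\mathrm{sym}}(X_1,\dots,X_n;N,\delta)$ is the set of $(\sigma_1,\dots,\sigma_n)\in S_N^n$ such that $(\sigma_1(\mathbf{x}_1),\dots,\sigma_n(\mathbf{x}_n))\in\Delta(X_1,\dots,X_n;N,\delta)$ for some $(\mathbf{x}_1,\dots,\mathbf{x}_n)\in(\mathcal{X}_\le^N)^n$. Define $$I_{\mathrm{sym}}(X_1,\dots,X_n):=-\lim_{\delta\searrow0}\limsup_{N\to\infty}\frac1N\log\gamma_{S_N}^{\otimes n}\bigl(\Delta_{\mathrm{sym}}(X_1,\dots,X_n;N,\delta)\bigr)$$ (with $\log0=-\infty$), and $\overline{I}_{\mathrm{sym}}(X_1,\dots,X_n)$ by replacing $\limsup$ by $\liminf$. *)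

(* Defs.v *)
From HB Require Import structures.
From mathcomp Require Export all_boot all_order all_algebra all_fingroup.
From mathcomp Require Export all_classical all_reals all_analysis.
Export Order.TTheory GRing.Theory Num.Theory.
Export numFieldNormedType.Exports.

Set Implicit Arguments.
Unset Strict Implicit.
Unset Printing Implicit Defensive.

Local Open Scope classical_set_scope.
Local Open Scope ring_scope.

(* Probability measures on a finite set are given by their mass functions. *)

Definition law {d} {T : measurableType d} {R : realType} (P : probability T R)
  {Y : Type} (Z : T -> Y) (y : Y) : R := fine (P (Z @^-1` [set y])).

Definition joint_rv {T Xs : Type} {n : nat} (X : 'I_n -> T -> Xs) (w : T) :
  n.-tuple Xs := [tuple X i w | i < n].

(* [ln 0 = 0], which gives the convention 0 log 0 = 0. *)
Definition entropy {R : realType} {Y : finType} (p : Y -> R) : R :=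
  - \sum_(y : Y) p y * ln (p y).

Definition seq_type {R : realType} {Y : finType} {N : nat} (y : N.-tuple Y)
  (t : Y) : R := #|[set j : 'I_N | tnth y j == t]%SET|%:R / N%:R.

Definition Delta {R : realType} {Y : finType} (p : Y -> R) (N : nat)
  (delta : R) : {set N.-tuple Y} :=
  [set y : N.-tuple Y | [forall t : Y, `|seq_type y t - p t| < delta]]%SET.

(* The identification of (Xs^N)^n with (Xs^n)^N. *)
Definition zip_seqs {Xs : Type} {n N : nat} (x : n.-tuple (N.-tuple Xs)) :
  N.-tuple (n.-tuple Xs) := [tuple [tuple tnth (tnth x i) j | i < n] | j < N].

Definition perm_seq {Xs : Type} {N : nat} (s : 'S_N) (x : N.-tuple Xs) :
  N.-tuple Xs := [tuple tnth x ((s^-1)%g j) | j < N].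

(* [k l] is the number of occurrences of [t l]; it is at most [N]. *)
Definition sorted_seqs {Xs : finType} {c : nat} (t : 'I_c -> Xs) (N : nat) :
  {set N.-tuple Xs} :=
  [set x : N.-tuple Xs | [exists k : {ffun 'I_c -> 'I_N.+1},
    tval x == flatten [seq nseq (k l) (t l) | l <- enum 'I_c]]]%SET.

Definition Delta_sym {R : realType} {Xs : finType} {c : nat} (t : 'I_c -> Xs)
  {n : nat} (p : n.-tuple Xs -> R) (N : nat) (delta : R) :
  {set n.-tuple 'S_N} :=
  [set s : n.-tuple 'S_N | [exists x : n.-tuple (N.-tuple Xs),
    [forall i, tnth x i \in sorted_seqs t N] &&
    (zip_seqs [tuple perm_seq (tnth s i) (tnth x i) | i < n]
       \in Delta p N delta)]]%SET.

Definition unif_perm (R : realType) (N : nat) (s : 'S_N) : R :=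
  #|[set: 'S_N]%SET|%:R^-1.

Definition prod_unif_perm {R : realType} {n N : nat} (A : {set n.-tuple 'S_N})
  : R := \sum_(s in A) \prod_(i < n) unif_perm R (tnth s i).

(* [lne 0 = -oo]. *)
Definition sym_rate {R : realType} {Xs : finType} {c : nat} (t : 'I_c -> Xs)
  {n : nat} (p : n.-tuple Xs -> R) (delta : R) (N : nat) : \bar R :=
  ((N%:R^-1)%:E * lne (prod_unif_perm (Delta_sym t p N delta))%:E)%E.

Definition I_sym {d} {T : measurableType d} {R : realType}
  (P : probability T R) {Xs : finType} {c : nat} (t : 'I_c -> Xs) {n : nat}
  (X : 'I_n -> T -> Xs) : \bar R :=
  (- lim (limn_esup (sym_rate t (law P (joint_rv X)) delta)
            @[delta --> (0%R : R)^'+]))%E.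

Definition I_sym_bar {d} {T : measurableType d} {R : realType}
  (P : probability T R) {Xs : finType} {c : nat} (t : 'I_c -> Xs) {n : nat}
  (X : 'I_n -> T -> Xs) : \bar R :=
  (- lim (limn_einf (sym_rate t (law P (joint_rv X)) delta)
            @[delta --> (0%R : R)^'+]))%E.

(* Both limits exist, so the uses of [lim] above are meaningful. *)

Lemma sym_rate_nd {R : realType} {Xs : finType} {c : nat} (t : 'I_c -> Xs)
  {n : nat} (p : n.-tuple Xs -> R) (N : nat) (a b : R) : a <= b ->
  (sym_rate t p a N <= sym_rate t p b N)%E.
Proof.
move=> ab; rewrite /sym_rate; apply: lee_wpmul2l.
  by rewrite lee_fin invr_ge0.
have h0 (A : {set n.-tuple 'S_N}) : 0 <= prod_unif_perm A :> R.
  by apply: sumr_ge0 => s _; apply: prodr_ge0 => i _; rewrite invr_ge0.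
rewrite lee_lne ?in_itv/= ?leey ?lee_fin ?h0 //.
rewrite /prod_unif_perm big_mkcond [leRHS]big_mkcond.
apply: ler_sum => s _.
have hp : 0 <= \prod_(i < n) unif_perm R (tnth s i).
  by apply: prodr_ge0 => i _; rewrite invr_ge0.
case: ifPn => [|_]; last by case: ifP.
rewrite inE => /existsP[x /andP[xs xD]].
rewrite inE; suff -> : [exists x : n.-tuple (N.-tuple Xs),
    [forall i, tnth x i \in sorted_seqs t N] &&
    (zip_seqs [tuple perm_seq (tnth s i) (tnth x i) | i < n]
       \in Delta p N b)] by [].
apply/existsP; exists x; rewrite xs /=; move: xD; rewrite !inE.
by move=> /forallP xD; apply/forallP => y; apply: lt_le_trans (xD y) ab.
Qed.

Lemma limn_esup_le_mono {R : realType} (u v : (\bar R)^nat) :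
  (forall N, u N <= v N)%E -> (limn_esup u <= limn_esup v)%E.
Proof.
move=> uv; rewrite !limn_esup_lim; apply: lee_lim.
- exact: is_cvg_esups.
- exact: is_cvg_esups.
near=> m; apply: ge_ereal_sup => _ [k /= mk <-].
by apply: le_trans (uv k) _; apply: ereal_sup_ubound; exists k.
Unshelve. all: by end_near. Qed.

Lemma I_sym_cvg {R : realType} {Xs : finType} {c : nat} (t : 'I_c -> Xs)
  {n : nat} (p : n.-tuple Xs -> R) :
  cvg (limn_esup (sym_rate t p delta) @[delta --> (0 : R)^'+]).
Proof.
apply: nondecreasing_at_right_is_cvge; near=> e => y z _ _ yz.
by apply: limn_esup_le_mono => N; exact: sym_rate_nd.
Unshelve. all: by end_near. Qed.

Lemma I_sym_bar_cvg {R : realType} {Xs : finType} {c : nat} (t : 'I_c -> Xs)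
  {n : nat} (p : n.-tuple Xs -> R) :
  cvg (limn_einf (sym_rate t p delta) @[delta --> (0 : R)^'+]).
Proof.
apply: nondecreasing_at_right_is_cvge; near=> e => y z _ _ yz.
rewrite /limn_einf leeN2; apply: limn_esup_le_mono => N.
by rewrite leeN2; exact: sym_rate_nd.
Unshelve. all: by end_near. Qed.

(* Main.v *)
(** Classify the pairs (permutations, sequences) by the type q of the joint
    sequence. A sorted sequence is determined by its type, so a fixed q pins
    down the sorted sequences x_i, and the permutations in S_N^n sending them to
    a joint sequence of type q have measure exactly |T(q)| / prod_i |T(q_i)|,
    where T denotes a type class and q_i is the i-th marginal of q. Writing
    |T(q)| as a multinomial coefficient and estimating the factorials, this
    measure is exp (- N C(q) + O(log N)) with C(q) = sum_i S(q_i) - S(q). There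
    are at most (N+1)^(|X|^n) types, every law is a limit of types, and C is
    continuous; so both rates tend to - C(p) as the window shrinks. *)

Require Import Defs.
From mathcomp Require Import lra ring unstable.

Set Implicit Arguments.
Unset Strict Implicit.
Unset Printing Implicit Defensive.

Local Open Scope classical_set_scope.
Local Open Scope ring_scope.

(** * Type classes and multinomial coefficients *)

Lemma sum_count_mem (Y : finType) (s : seq Y) :
  (\sum_a count_mem a s)%N = size s.
Proof.
rewrite -[RHS]sum1_size [RHS](partition_big id predT) //=.
by apply: eq_bigr => a _; rewrite sum1_count.
Qed.

(** Two sequences of length N have the same type exactly when one rearranges the other. The
    representative is a plain [seq], so that an induction on the length can delete a letter from
    it. *)
Definition type_class {Y : finType} {N : nat} (s : seq Y) : {set N.-tuple Y} :=
  [set z : N.-tuple Y | perm_eq z s]%SET.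

Lemma mem_type_class (Y : finType) (N : nat) (s : seq Y) (z : N.-tuple Y) :
  (z \in type_class s) = perm_eq z s.
Proof. by rewrite inE. Qed.

(** Induction on N, sorting the rearrangements of [s] by first letter: those starting with [a]
    correspond to rearrangements of [rem a s]. Peeling one [a] off the product of factorials gives
    the factor [count_mem a s], and these factors add up to the length. *)
Lemma card_type_class (Y : finType) (N : nat) (s : seq Y) : size s = N ->
  (#|@type_class Y N s| * \prod_a (count_mem a s)`!)%N = N`!.
Proof.
elim: N s => [|N IH] s sN.
  move/size0nil: sN => ->; rewrite big1 ?muln1 //.
  rewrite (_ : type_class _ = [set [tuple]]%SET) ?cards1 //.
  by apply/setP => z; rewrite mem_type_class inE tuple0 eqxx.
rewrite -sum1_card (partition_big (@thead N Y) predT) //= big_distrl /=.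
transitivity (\sum_a N`! * count_mem a s)%N; last first.
  by rewrite -big_distrr /= sum_count_mem sN factS mulnC.
apply: eq_bigr => a _; rewrite sum1_card.
have [as_|as_] := boolP (a \in s); last first.
  rewrite (count_memPn as_) muln0 eq_card0 ?mul0n // => z.
  rewrite unfold_in mem_type_class.
  apply/andP => -[/perm_mem zs /eqP za]; move/negP: as_; apply.
  by rewrite -zs -za [z]tuple_eta theadE mem_head.
have sr : perm_eq s (a :: rem a s) by apply: perm_to_rem.
have -> : (\prod_b (count_mem b s)`!)%N =
    (count_mem a s * \prod_b (count_mem b (rem a s))`!)%N.
  rewrite (bigD1 a) // [in RHS](bigD1 a) //= mulnA.
  rewrite (seq.permP sr) /= eqxx factS; congr (_ * _)%N.
  by apply: eq_bigr => b ba; rewrite (seq.permP sr) /= eq_sym (negbTE ba).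
rewrite mulnCA mulnC; congr (_ * _)%N.
rewrite -(IH (rem a s)) ?size_rem ?sN //; congr (_ * _)%N.
rewrite -[RHS](card_imset _ (f := fun z : N.-tuple Y => cons_tuple a z)); last first.
  by move=> z1 z2 /(congr1 val) [] /val_inj.
apply: eq_card => z; apply/idP/imsetP => [|[z' z's ->]].
  rewrite unfold_in mem_type_class => /andP[zs /eqP za].
  have ez : z = cons_tuple a [tuple of behead z].
    by rewrite -za; apply: val_inj; rewrite [z in LHS]tuple_eta.
  exists [tuple of behead z] => //; rewrite mem_type_class -(perm_cons a).
  by rewrite -(permPr sr); move: zs; rewrite {1}ez.
rewrite mem_type_class in z's.
rewrite unfold_in mem_type_class theadE eqxx andbT.
by rewrite (permPr sr) perm_cons.
Qed.

(** * The action of permutations on sequences *)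

(** The order is reversed because a product of permutations applies its left factor first. *)
Lemma perm_seqM (Y : finType) N (a b : 'S_N) (x : N.-tuple Y) :
  perm_seq a (perm_seq b x) = perm_seq (b * a)%g x.
Proof. by apply: eq_from_tnth => j; rewrite !tnth_mktuple invMg permM. Qed.

Lemma perm_seqP (Y : finType) N (x z : N.-tuple Y) :
  reflect (exists s, z = perm_seq s x) (perm_eq z x).
Proof.
apply: (iffP tuple_permP) => [[p zp]|[s ->]].
  by exists (p^-1)%g; rewrite /perm_seq invgK; apply: val_inj.
by exists (s^-1)%g.
Qed.

(** The fibers are right translates of the stabilizer of [x], so they all have the same size. They
    partition the group over the type class of [x], and comparing with [card_type_class] gives that
    size. *)
Lemma card_perm_seq_fiber (Y : finType) N (x z : N.-tuple Y) : perm_eq z x ->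
  #|[set s : 'S_N | perm_seq s x == z]%SET| =
    (\prod_a (count_mem a x)`!)%N.
Proof.
have fibE (r : 'S_N) : #|[set s : 'S_N | perm_seq s x == perm_seq r x]%SET| =
    #|[set s : 'S_N | perm_seq s x == x]%SET|.
  rewrite -[RHS](card_imset _ (mulIg r)).
  apply: eq_card => s; apply/idP/imsetP => [|[s' s'x ->]].
    rewrite inE => /eqP sr; exists (s * r^-1)%g; rewrite ?mulgKV //.
    rewrite inE -perm_seqM sr perm_seqM mulgV.
    by apply/eqP/eq_from_tnth => j; rewrite tnth_mktuple invg1 perm1.
  by move: s'x; rewrite !inE -perm_seqM => /eqP ->.
move=> /perm_seqP[r ->]; rewrite fibE.
have cpos : (0 < #|@type_class Y N x|)%N.
  by apply/card_gt0P; exists x; rewrite mem_type_class.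
apply/eqP; rewrite -(eqn_pmul2l cpos) card_type_class ?size_tuple //.
apply/eqP; transitivity (\sum_(z in @type_class Y N x)
    #|[set s : 'S_N | perm_seq s x == z]%SET|)%N.
  rewrite -sum_nat_const; apply: eq_bigr => y; rewrite mem_type_class.
  by move=> /perm_seqP[s ->]; rewrite fibE.
rewrite -[RHS]card_Sn -cardsT -sum1_card.
rewrite (partition_big (fun s => perm_seq s x) (mem (@type_class Y N x))) /=.
  by apply: eq_bigr => y _; rewrite -sum1_card; apply: eq_bigl => s; rewrite !inE.
by move=> s _; rewrite mem_type_class; apply/perm_seqP; exists s.
Qed.

(** * Sorted sequences *)

Lemma count_flatten_nseq (Y I : finType) (f : I -> Y) (k : I -> nat) (b : Y) :
  injective f -> forall i, f i = b ->
  count_mem b (flatten [seq nseq (k j) (f j) | j <- enum I]) = k i.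
Proof.
move=> finj i <-; rewrite count_flatten -map_comp sumnE big_map big_enum /=.
rewrite (bigD1 i) //= count_nseq /= eqxx mul1n big1 ?addn0 // => j ji.
by rewrite count_nseq /= (inj_eq finj) (negbTE ji) mul0n.
Qed.

(** By injectivity of [t] no letter occurs in two blocks, so the block lengths are the letter
    counts. *)
Lemma sorted_seqs_uniq (Xs : finType) c (t : 'I_c -> Xs) N
  (x y : N.-tuple Xs) : injective t ->
  x \in sorted_seqs t N -> y \in sorted_seqs t N -> perm_eq x y -> x = y.
Proof.
move=> tinj; rewrite !inE => /existsP[k /eqP xk] /existsP[l /eqP yl] xy.
apply: val_inj; rewrite /= xk yl; congr flatten; apply: eq_map => i.
have := seq.permP xy (pred1 (t i)); rewrite xk yl.
by rewrite !(count_flatten_nseq _ tinj (erefl (t i))) => ->.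
Qed.

(** Surjectivity of [t] gives every letter of [x] a block, whose length is taken to be its count. *)
Lemma sorted_seqs_ex (Xs : finType) c (t : 'I_c -> Xs) N (x : N.-tuple Xs) :
  bijective t -> exists2 y, y \in sorted_seqs t N & perm_eq y x.
Proof.
move=> tbij; have [t' _ tK'] := tbij.
pose k i := count_mem (t i) x.
pose s := flatten [seq nseq (k i) (t i) | i <- enum 'I_c].
have sx : perm_eq s x.
  apply/allP => a _ /=; apply/eqP.
  by rewrite (count_flatten_nseq _ (bij_inj tbij) (tK' a)) /k tK'.
have sN : size s == N by rewrite (perm_size sx) size_tuple.
exists (Tuple sN) => //; rewrite inE; apply/existsP.
have kN i : (k i < N.+1)%N.
  by rewrite ltnS -[leqRHS](size_tuple x) count_size.
exists [ffun i => Ordinal (kN i)]; apply/eqP => /=.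
by congr flatten; apply: eq_map => i; rewrite ffunE.
Qed.

(** * Permutation tuples that produce a given joint type *)

Lemma card_tuple_family (I : finType) n (F : 'I_n -> {set I}) :
  #|[set s : n.-tuple I | [forall i, tnth s i \in F i]]%SET| =
    (\prod_(i < n) #|F i|)%N.
Proof.
transitivity #|family (fun i => mem (F i))|; last first.
  by rewrite card_family foldrE big_map big_enum.
pose g (f : {ffun 'I_n -> I}) := [tuple f i | i < n].
rewrite -(card_imset _ (f := g)); last first.
  move=> f f' ff'; apply/ffunP => i.
  by rewrite -[f i](tnth_mktuple f) -[f' i](tnth_mktuple f') -/(g f) ff'.
apply: eq_card => s; apply/idP/imsetP => [|[f /familyP fF ->]].
  rewrite inE => /forallP sF; exists [ffun i => tnth s i].
    by apply/familyP => i; rewrite ffunE sF.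
  by apply: eq_from_tnth => i; rewrite tnth_mktuple ffunE.
by rewrite inE; apply/forallP => i; rewrite tnth_mktuple fF.
Qed.

Definition component {Xs : finType} {n N : nat} (y : N.-tuple (n.-tuple Xs))
  (i : 'I_n) : N.-tuple Xs := map_tuple (fun b => tnth b i) y.

Lemma eq_zip_seqs (Xs : finType) n N (x : n.-tuple (N.-tuple Xs))
  (y : N.-tuple (n.-tuple Xs)) :
  (zip_seqs x == y) = [forall i, tnth x i == component y i].
Proof.
apply/eqP/forallP => [<- i|xy].
  by apply/eqP/eq_from_tnth => j; rewrite tnth_map !tnth_mktuple.
apply/eq_from_tnth => j; apply/eq_from_tnth => i.
by rewrite !tnth_mktuple (eqP (xy i)) tnth_map.
Qed.

Lemma component_perm (Xs : finType) n N (y z : N.-tuple (n.-tuple Xs)) i :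
  perm_eq y z -> perm_eq (component y i) (component z i).
Proof. exact: perm_map. Qed.

(** The piece of [Delta_sym] belonging to one joint type: [Delta_sym] is the union of these sets
    over [y] in [Delta]. *)
Definition sym_class {Xs : finType} {c : nat} (t : 'I_c -> Xs) {n N : nat}
  (y : N.-tuple (n.-tuple Xs)) : {set n.-tuple 'S_N} :=
  [set s : n.-tuple 'S_N | [exists x : n.-tuple (N.-tuple Xs),
    [forall i, tnth x i \in sorted_seqs t N] &&
    perm_eq (zip_seqs [tuple perm_seq (tnth s i) (tnth x i) | i < n]) y]]%SET.

(** The only possible sorted sequences are the sorted components of [y]. With them fixed, the class
    fibers over the type class of [y], and each fiber is a product over [i] of fibers of the action
    of a single permutation. *)
Lemma card_sym_class (Xs : finType) c (t : 'I_c -> Xs) n N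
  (y : N.-tuple (n.-tuple Xs)) : bijective t ->
  #|sym_class t y| = (#|@type_class _ N y| *
    \prod_(i < n) \prod_a (count_mem a (component y i))`!)%N.
Proof.
move=> tbij.
have [x0 x0s x0y] := fin_all_exists2
  (fun i => sorted_seqs_ex (component y i) tbij).
pose x := [tuple x0 i | i < n].
pose act (s : n.-tuple 'S_N) := [tuple perm_seq (tnth s i) (tnth x i) | i < n].
have classE s : (s \in sym_class t y) = perm_eq (zip_seqs (act s)) y.
  rewrite inE; apply/existsP/idP => [[x' /andP[/forallP x's x'y]]|sy]; last first.
    exists x; rewrite sy andbT; apply/forallP => i.
    by rewrite tnth_mktuple.
  suff xx' : x = x' by rewrite /act xx'.
  apply: eq_from_tnth => i; rewrite tnth_mktuple.
  apply: (sorted_seqs_uniq (bij_inj tbij)) => //.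
  apply: perm_trans (x0y i) _; rewrite perm_sym.
  (* Reflexivity is read through [eq_zip_seqs]: the components of a joint sequence are the sequences
     it was zipped from. *)
  have /eqP := erefl (zip_seqs [tuple perm_seq (tnth s i) (tnth x' i) | i < n]).
  rewrite eq_zip_seqs => /forallP/(_ i); rewrite tnth_mktuple => /eqP e.
  apply: perm_trans (component_perm i x'y); rewrite -e perm_sym.
  by apply/perm_seqP; exists (tnth s i).
rewrite -sum1_card (partition_big (fun s => zip_seqs (act s))
  (mem (@type_class _ N y))) /=; last first.
  by move=> s; rewrite classE mem_type_class.
rewrite -sum_nat_const; apply: eq_bigr => z; rewrite mem_type_class => zy.
have zx i : perm_eq (component z i) (x0 i).
  by rewrite perm_sym (permPl (x0y i)) perm_sym component_perm.
transitivity (\prod_(i < n)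
    #|[set s : 'S_N | perm_seq s (x0 i) == component z i]%SET|)%N; last first.
  apply: eq_bigr => i _; rewrite card_perm_seq_fiber ?zx //.
  by apply: eq_bigr => a _; rewrite (seq.permP (x0y i)).
rewrite -card_tuple_family sum1_card; apply: eq_card => s.
rewrite [LHS]unfold_in classE inE eq_zip_seqs.
have sE : [forall i, tnth (act s) i == component z i] =
    [forall i, tnth s i \in [set u : 'S_N | perm_seq u (x0 i) == component z i]%SET].
  by apply: eq_forallb => i; rewrite inE !tnth_mktuple.
(* Producing [z] itself already places the tuple in the class, since [z] has the type of [y]. *)
rewrite -sE andb_idl // -eq_zip_seqs => /eqP ->.
exact: zy.
Qed.

Lemma prod_unif_permE (R : realType) n N (A : {set n.-tuple 'S_N}) :
  prod_unif_perm A = #|A|%:R / N`!%:R ^+ n :> R.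
Proof.
rewrite /prod_unif_perm -sumr_const mulr_suml; apply: eq_bigr => s _.
by rewrite prodr_const card_ord /unif_perm cardsT card_Sn mul1r exprVn.
Qed.

(** * Elementary factorial estimates *)

Lemma le_ln_fact (R : realType) (k : nat) :
  k%:R * ln k%:R - k%:R <= ln k`!%:R :> R.
Proof.
elim: k => [|k IH]; first by rewrite mul0r subr0 ln1.
rewrite factS natrM lnM ?posrE ?ltr0n ?fact_gt0 //.
have [->|k0] := posnP k; first by rewrite !ln1; lra.
(* This is [ln (1 + 1/k) <= 1/k]. *)
suff : k%:R * (ln k.+1%:R - ln k%:R) <= 1 :> R.
  by move: IH; rewrite -natr1; lra.
rewrite -ln_div ?posrE ?ltr0n // -natr1 mulrDl divff ?pnatr_eq0 -?lt0n //.
rewrite -[leRHS](@mulfV _ k%:R) ?pnatr_eq0 -?lt0n // ler_wpM2l //.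
rewrite div1r le_ln1Dx //; apply: (@lt_trans _ _ 0) => //.
by rewrite invr_gt0 ltr0n.
Qed.

(* For [k = 0] this relies on [ln 0 = 0]. *)
Lemma ge_ln_fact (R : realType) (k : nat) :
  ln k`!%:R <= k%:R * ln k%:R - k%:R + 1 + ln k%:R :> R.
Proof.
elim: k => [|k IH]; first by rewrite mul0r fact0 ln1 ln0 //; lra.
rewrite factS natrM lnM ?posrE ?ltr0n ?fact_gt0 //.
have [->|k0] := posnP k; first by rewrite !ln1; lra.
(* This is [ln (1 - 1/(k+1)) <= - 1/(k+1)]. *)
suff : 1 <= k.+1%:R * (ln k.+1%:R - ln k%:R) :> R.
  by move: IH; rewrite -!natr1; lra.
rewrite -ler_pdivrMl ?ltr0n // mulr1.
rewrite -lerN2 opprB -ln_div ?posrE ?ltr0n //.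
have -> : k%:R / k.+1%:R = 1 + - k.+1%:R^-1 :> R.
  rewrite -[in LHS](addrK 1 k%:R) natr1 mulrBl divff ?pnatr_eq0 //.
  by rewrite mul1r.
by apply: le_ln1Dx; rewrite ltrN2 invf_lt1 ?ltr0n // ltr1n.
Qed.

(** * Types, marginals and the entropy estimate of a class *)

Lemma card_tnth_count (Y : eqType) N (y : N.-tuple Y) (b : Y) :
  #|[set j : 'I_N | tnth y j == b]%SET| = count_mem b y.
Proof.
rewrite cardsE cardE size_filter -[in RHS](map_tnth_enum y) count_map enumT.
exact: eq_count.
Qed.

Lemma seq_typeE (R : realType) (Y : finType) N (y : N.-tuple Y) (b : Y) :
  seq_type y b = (count_mem b y)%:R / N%:R :> R.
Proof. by rewrite /seq_type card_tnth_count. Qed.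

Definition marginal {R : realType} {Xs : finType} {n : nat}
  (q : n.-tuple Xs -> R) (i : 'I_n) (a : Xs) : R :=
  \sum_(b | tnth b i == a) q b.

Lemma marginal_seq_type (R : realType) (Xs : finType) n N
  (y : N.-tuple (n.-tuple Xs)) (i : 'I_n) (a : Xs) :
  marginal (seq_type y) i a = seq_type (component y i) a :> R.
Proof.
rewrite seq_typeE /marginal /= count_map.
rewrite (eq_bigr _ (fun b _ => seq_typeE R y b)) -mulr_suml -natr_sum.
congr (_%:R / _).
rewrite -[RHS]sum1_count [RHS](partition_big id (fun b => tnth b i == a)) //=.
apply: eq_bigr => b ba; rewrite -[LHS]sum1_count; apply: eq_bigl => b' /=.
by case: eqP => [->|]; rewrite ?ba ?andbF.
Qed.

(* By [card_type_class], the logarithm of the number of sequences with the same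
   type as [y]. *)
Definition log_multinomial {R : realType} {Y : finType} {N : nat}
  (y : N.-tuple Y) : R := ln N`!%:R - \sum_b ln (count_mem b y)`!%:R.

(** Replace each [ln k!] by [k ln k - k]. The linear terms cancel because the counts sum to N, and
    what remains is N times the entropy. Each of the [#|Y|.+1] factorials costs at most
    [1 + ln (N+1)]. *)
Lemma log_multinomial_entropy (R : realType) (Y : finType) N
  (y : N.-tuple Y) : (0 < N)%N ->
  `|log_multinomial y - N%:R * entropy (seq_type y)|
    <= (#|Y|.+1)%:R * (1 + ln N.+1%:R) :> R.
Proof.
move=> N0; pose k b : R := (count_mem b y)%:R.
have NR : (0 : R) < N%:R by rewrite ltr0n.
have kN : \sum_b k b = N%:R.
  by rewrite /k -natr_sum sum_count_mem size_tuple.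
have HE : N%:R * entropy (seq_type y) =
    N%:R * ln N%:R - N%:R - \sum_b (k b * ln (k b) - k b).
  rewrite sumrB kN opprB addrA subrK /entropy mulrN mulr_sumr.
  rewrite -{2}kN mulr_suml -sumrB -sumrN; apply: eq_bigr => b _.
  rewrite seq_typeE -/(k b); have [k0|k0] := eqVneq (k b) 0.
    by rewrite k0 !mul0r; lra.
  have kp : 0 < k b by rewrite lt0r k0 ler0n.
  by rewrite ln_div ?posrE // mulrA [N%:R * _]mulrC divfK ?gt_eqF //; lra.
have lnN : 0 <= ln N.+1%:R :> R by rewrite ln_ge0 // ler1n.
have lo : \sum_b (k b * ln (k b) - k b) <= \sum_b ln (count_mem b y)`!%:R.
  by apply: ler_sum => b _; exact: le_ln_fact.
have up : \sum_b ln (count_mem b y)`!%:R <=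
    \sum_b (k b * ln (k b) - k b) + #|Y|%:R * (1 + ln N.+1%:R).
  have -> : #|Y|%:R * (1 + ln N.+1%:R) = \sum_(b : Y) (1 + ln N.+1%:R) :> R.
    by rewrite sumr_const mulr_natl.
  rewrite -big_split; apply: ler_sum => b _.
  apply: le_trans (ge_ln_fact _ _) _; rewrite -/(k b) -addrA lerD2l lerD2l.
  (* For an absent letter the bound rests on the default value [ln 0 = 0]. *)
  have [k0|k0] := posnP (count_mem b y); first by rewrite /k k0 ln0.
  rewrite ler_ln ?posrE ?ltr0n // ler_nat leqW //.
  by rewrite -[leqRHS](size_tuple y) count_size.
have lnNS : ln N%:R <= ln N.+1%:R :> R by rewrite ler_ln ?posrE ?ltr0n // ler_nat.
have := le_ln_fact R N; have := ge_ln_fact R N.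
have : 0 <= #|Y|%:R * (1 + ln N.+1%:R) :> R by rewrite mulr_ge0 // addr_ge0.
rewrite /log_multinomial HE ler_norml -[#|Y|.+1%:R]natr1; move: lo up lnN lnNS.
set S1 := \sum_b _; set S2 := \sum_b _; set L := ln N.+1%:R.
set yy := #|Y|%:R; move=> *; apply/andP; split; lra.
Qed.

(** For a probability [q] this is the relative entropy of [q] with respect to the product of its
    marginals. *)
Definition total_correlation {R : realType} {Xs : finType} {n : nat}
  (q : n.-tuple Xs -> R) : R :=
  \sum_(i < n) entropy (marginal q i) - entropy q.

(** Total number of factorials estimated: one batch for the joint sequence and one for each of its n
    components. *)
Definition sym_const (Xs : finType) (n : nat) : nat :=
  (#|{: n.-tuple Xs}|.+1 + n * #|Xs|.+1)%N.

(** One factor [N!] of the denominator goes to each component, turning its product of factorials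
    into an inverse multinomial coefficient. Positivity is recorded because [ln] is inverted
    later. *)
Lemma ln_sym_class (R : realType) (Xs : finType) c (t : 'I_c -> Xs) n N
  (y : N.-tuple (n.-tuple Xs)) : bijective t ->
  0 < prod_unif_perm (sym_class t y) :> R /\
  ln (prod_unif_perm (sym_class t y)) =
    log_multinomial y - \sum_(i < n) log_multinomial (component y i) :> R.
Proof.
move=> tbij.
have lnprod (I : finType) (f : I -> nat) : (forall i, 0 < f i)%N ->
    ln (\prod_i f i)%:R = \sum_i ln (f i)%:R :> R.
  move=> fp; suff [] : (0 < \prod_i f i)%N /\
    ln (\prod_i f i)%:R = \sum_i ln (f i)%:R :> R by [].
  elim/big_rec2: _ => [|i x m _ [m0 <-]]; first by rewrite ln1.
  by rewrite muln_gt0 fp m0 natrM lnM ?posrE ?ltr0n.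
have pp (Y : finType) (s : seq Y) : (0 < \prod_a (count_mem a s)`!)%N.
  by apply: prodn_gt0 => a; exact: fact_gt0.
have cpos : (0 < #|@type_class _ N y|)%N.
  by apply/card_gt0P; exists y; rewrite mem_type_class.
have pcpos : (0 < \prod_(i < n) \prod_a (count_mem a (component y i))`!)%N.
  by apply: prodn_gt0 => i; exact: pp.
have NX : 0 < N`!%:R ^+ n :> R by rewrite exprn_gt0 // ltr0n fact_gt0.
rewrite prod_unif_permE card_sym_class //; split.
  by rewrite divr_gt0 // ltr0n muln_gt0 cpos.
rewrite ln_div ?posrE ?ltr0n ?muln_gt0 ?cpos // natrM lnM ?posrE ?ltr0n //.
rewrite lnprod; last by move=> i; exact: pp.
have -> : ln #|@type_class _ N y|%:R = log_multinomial y :> R.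
  rewrite /log_multinomial -lnprod; last by move=> b; exact: fact_gt0.
  rewrite -(card_type_class (size_tuple y)) natrM lnM ?posrE ?ltr0n ?pp //.
  by rewrite addrK.
rewrite lnXn ?ltr0n ?fact_gt0 // -addrA; congr (_ + _).
rewrite /log_multinomial sumrB sumr_const card_ord opprB addrC.
rewrite addrC; congr (_ - _); apply: eq_bigr => i _.
by rewrite lnprod // => a; exact: fact_gt0.
Qed.

Lemma ln_sym_class_approx (R : realType) (Xs : finType) c (t : 'I_c -> Xs) n N
  (y : N.-tuple (n.-tuple Xs)) : bijective t -> (0 < N)%N ->
  `|ln (prod_unif_perm (sym_class t y)) + N%:R * total_correlation (seq_type y)|
    <= (sym_const Xs n)%:R * (1 + ln N.+1%:R) :> R.
Proof.
move=> tbij N0; have [_ ->] := ln_sym_class R y tbij.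
pose L : R := 1 + ln N.+1%:R.
have e : log_multinomial y - \sum_(i < n) log_multinomial (component y i) +
    N%:R * total_correlation (seq_type y) =
    (log_multinomial y - N%:R * entropy (seq_type y)) -
    \sum_(i < n) (log_multinomial (component y i) -
       N%:R * entropy (seq_type (component y i))) :> R.
  have -> : total_correlation (seq_type y) =
      \sum_(i < n) entropy (seq_type (component y i)) - entropy (seq_type y) :> R.
    congr (_ - _); apply: eq_bigr => i _; congr entropy; apply/funext => a.
    exact: marginal_seq_type.
  by rewrite [in RHS]sumrB -mulr_sumr mulrBr; lra.
rewrite e; apply: le_trans (ler_normB _ _) _.
rewrite natrD natrM mulrDl lerD ?log_multinomial_entropy //.
apply: le_trans (ler_norm_sum _ _ _) _.
rewrite -mulrA mulr_natl -[X in _ <= _ *+ X](card_ord n) -sumr_const.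
by apply: ler_sum => i _; exact: log_multinomial_entropy.
Qed.

(** * Continuity of entropy and total correlation *)

(** The filter of uniform neighbourhoods of [p]. Its basic sets are the windows that define [Delta],
    so convergence along it applies directly to types. *)
Definition close_to {R : realType} {Y : Type} (p : Y -> R) :
  set_system (Y -> R) :=
  filter_from [set d : R | 0 < d] (fun d => [set q | forall b, `|q b - p b| < d]).

#[local] Instance close_to_filter (R : realType) (Y : Type) (p : Y -> R) :
  Filter (close_to p).
Proof.
apply: filter_from_filter; first by exists 1 => /=.
move=> d e /= d0 e0; exists (Num.min d e); first by rewrite /= lt_min d0.
by move=> q /= qp; split=> b; have := qp b; rewrite lt_min => /andP[].
Qed.

Lemma cvg_close_to (R : realType) (Y : Type) (p : Y -> R) (b : Y) :
  q b @[q --> close_to p] --> p b.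
Proof.
apply/cvgrPdist_lt => e e0; exists e => //= q qp.
by rewrite distrC; exact: qp.
Qed.

(** The free slope [1/a] serves twice: for [y ln y] near 0 and for [ln N] against N. *)
Lemma ln_le_line (R : realType) (a x : R) : 0 < a -> 0 < x ->
  ln x <= x / a + ln a.
Proof.
move=> a0 x0; rewrite -lerBlDr -ln_div ?posrE //.
by apply/ltW/ln_sublinear; rewrite divr_gt0.
Qed.

Lemma continuous_xlnx (R : realType) (x : R) : 0 <= x ->
  {for x, continuous (fun y : R => y * ln y)}.
Proof.
rewrite le_eqVlt => /predU1P[<-|x0]; last first.
  by apply: cvgM; [exact: cvg_id|exact: continuous_ln].
rewrite /prop_for /continuous_at mul0r; apply/cvgrPdist_lt => e e0.
(* In [y ln (1/y) <= 1/a + y ln a] the first term becomes [e / 2]; the second is small with [y]. *)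
pose a : R := 2 / e; have a0 : 0 < a by rewrite divr_gt0.
near=> y; rewrite sub0r normrN.
have [y0|y0] := leP y 0; first by rewrite ln0 // mulr0 normr0.
have y1 : y <= 1 by apply: ltW; near: y; exact: lt_nbhsl.
rewrite ler0_norm ?mulr_ge0_le0 ?ln_le0 ?(ltW y0) //.
have ya : y * (1 + `|ln a|) < e / 2.
  rewrite -ltr_pdivlMr ?ltr_pwDl //.
  by near: y; apply: lt_nbhsl; rewrite !divr_gt0 ?ltr_pwDl.
have : y * ln y^-1 <= y * (y^-1 / a + ln a).
  by rewrite ler_pM2l // ln_le_line // invr_gt0.
rewrite lnV ?posrE // mulrDr mulrA mulfV ?gt_eqF // mul1r invf_div.
have : y * ln a <= y * `|ln a| by rewrite ler_pM2l // ler_norm.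
move: ya; rewrite mulrN; lra.
Unshelve. all: by end_near. Qed.

Lemma cvg_sumr (R : realType) (T : Type) (F : set_system T) (I : Type)
  (r : seq I) (Q : pred I) (f : I -> T -> R) (l : I -> R) : Filter F ->
  (forall i, Q i -> f i x @[x --> F] --> l i) ->
  \sum_(i <- r | Q i) f i x @[x --> F] --> \sum_(i <- r | Q i) l i.
Proof. by move=> FF; apply: cvg_big => //; exact: add_continuous. Qed.

Lemma cvg_entropy (R : realType) (T : Type) (F : set_system T) (Y : finType)
  (q : T -> Y -> R) (p : Y -> R) : Filter F -> (forall b, 0 <= p b) ->
  (forall b, q x b @[x --> F] --> p b) ->
  entropy (q x) @[x --> F] --> entropy p.
Proof.
move=> FF p0 qp; apply: cvgN; apply: cvg_sumr => b _.
exact: (continuous_cvg _ (continuous_xlnx (p0 b)) (qp b)).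
Qed.

Lemma cvg_total_correlation (R : realType) (Xs : finType) n
  (p : n.-tuple Xs -> R) : (forall b, 0 <= p b) ->
  total_correlation q @[q --> close_to p] --> total_correlation p.
Proof.
move=> p0; apply: cvgB; last by apply: cvg_entropy => // b; exact: cvg_close_to.
apply: cvg_sumr => i _; apply: cvg_entropy => [a|a]; first exact: sumr_ge0.
by apply: cvg_sumr => b _; exact: cvg_close_to.
Qed.

(** * Approximation of a law by types *)

(** Round each [N p(b)] down and fill the at most [#|Y|] remaining positions with one fixed letter;
    every frequency is then off by at most [(1 + #|Y|) / N]. *)
Lemma Delta_neq0 (R : realType) (Y : finType) (p : Y -> R) (delta : R) :
  (forall b, 0 <= p b) -> \sum_b p b = 1 -> 0 < delta ->
  \forall N \near \oo, exists y : N.-tuple Y, y \in Delta p N delta.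
Proof.
move=> p0 p1 delta0.
have [b0 _|Y0] := pickP (@predT Y); last first.
  by move/eqP: p1; rewrite big_pred0 // eq_sym oner_eq0.
near=> N.
have NR : (0 : R) < N%:R by rewrite ltr0n; near: N; exists 1%N.
pose k b := Num.truncn (N%:R * p b).
have Np b : 0 <= N%:R * p b by rewrite mulr_ge0.
have kp b : (k b)%:R <= N%:R * p b < (k b)%:R + 1.
  by have := truncn_itv (Np b); rewrite -natr1.
pose K := (\sum_b k b)%N.
have sumNp : \sum_b N%:R * p b = N%:R by rewrite -mulr_sumr p1 mulr1.
have KN : (K <= N)%N.
  rewrite -(ler_nat R) natr_sum -[leRHS]sumNp; apply: ler_sum => b _.
  by have /andP[] := kp b.
have NK : N%:R <= K%:R + #|Y|%:R :> R.
  rewrite -[leLHS]sumNp natr_sum -sum1_card natr_sum -big_split /=.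
  by apply: ler_sum => b _; apply/ltW; have /andP[] := kp b.
pose s := flatten [seq nseq (k b) b | b <- enum Y] ++ nseq (N - K) b0.
have sN : size s == N.
  rewrite size_cat size_flatten /shape -map_comp sumnE big_map big_enum /=.
  rewrite size_nseq (eq_bigr k) ?subnKC // => b _.
  by rewrite size_nseq.
exists (Tuple sN); rewrite inE; apply/forallP => b.
rewrite seq_typeE /= count_cat (count_flatten_nseq k (@inj_id Y) (erefl b)).
rewrite count_nseq /= natrD natrM natrB //.
have -> : ((k b)%:R + (b0 == b)%:R * (N%:R - K%:R)) / N%:R - p b =
    ((k b)%:R + (b0 == b)%:R * (N%:R - K%:R) - N%:R * p b) / N%:R.
  by rewrite mulrBl [N%:R * _]mulrC mulfK ?gt_eqF.
rewrite normrM normfV (gtr0_norm NR) ltr_pdivrMr //.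
apply: (@le_lt_trans _ _ (1 + #|Y|%:R)).
  move: KN; rewrite -(ler_nat R) => KN.
  have /andP[k1 k2] := kp b; have Y0 := ler0n R #|Y|.
  case: eqP => _; rewrite ?mul1r ?mul0r ler_norml; apply/andP; split; lra.
rewrite mulrC -ltr_pdivrMr //.
near: N; exact: nbhs_infty_gtr.
Unshelve. all: by end_near. Qed.

(** * The number of types and the union bound *)

(** Encodes the type in a finite type with [(N+1)^#|Y|] elements; [inord] loses nothing, as counts
    are at most N. *)
Definition counts {Y : finType} {N : nat} (y : N.-tuple Y) :
  {ffun Y -> 'I_N.+1} := [ffun b => inord (count_mem b y)].

Lemma counts_inj (Y : finType) N (y z : N.-tuple Y) :
  counts y = counts z -> perm_eq y z.
Proof.
have cN (x : N.-tuple Y) b : (count_mem b x < N.+1)%N.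
  by rewrite ltnS -[leqRHS](size_tuple x) count_size.
move=> yz; apply/allP => b _ /=; apply/eqP.
move/ffunP/(_ b)/(congr1 val): yz.
by rewrite !ffunE /= !inordK.
Qed.

Lemma sym_class_sub (R : realType) (Xs : finType) c (t : 'I_c -> Xs) n
  (p : n.-tuple Xs -> R) N delta (y : N.-tuple (n.-tuple Xs)) :
  y \in Delta p N delta -> sym_class t y \subset Delta_sym t p N delta.
Proof.
move=> yD; apply/fintype.subsetP => s; rewrite !inE => /existsP[x /andP[xs xy]].
apply/existsP; exists x; rewrite xs /=; move: yD; rewrite !inE => /forallP yD.
apply/forallP => b; rewrite seq_typeE (seq.permP xy) -seq_typeE; exact: yD.
Qed.

Lemma ler_prod_unif_perm (R : realType) n N (A B : {set n.-tuple 'S_N}) :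
  A \subset B -> prod_unif_perm A <= prod_unif_perm B :> R.
Proof.
move=> AB; rewrite !prod_unif_permE ler_wpM2r ?invr_ge0 ?exprn_ge0 //.
by rewrite ler_nat subset_leq_card.
Qed.

Lemma Delta_sym_le (R : realType) (Xs : finType) c (t : 'I_c -> Xs) n
  (p : n.-tuple Xs -> R) N delta (M : R) : 0 <= M ->
  (forall y, y \in Delta p N delta -> prod_unif_perm (sym_class t y) <= M) ->
  prod_unif_perm (Delta_sym t p N delta) <= N.+1%:R ^+ #|{: n.-tuple Xs}| * M.
Proof.
move=> M0 yM.
(* One representative in [Delta] is chosen per count function; its class depends only on the
   counts. *)
pose B (k : {ffun n.-tuple Xs -> 'I_N.+1}) :=
  if [pick y in Delta p N delta | counts y == k] is Some y
  then sym_class t y else finset.set0.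
have sub : Delta_sym t p N delta \subset (\bigcup_k B k)%SET.
  apply/fintype.subsetP => s; rewrite inE => /existsP[x /andP[xs xy]].
  set y := zip_seqs _ in xy; apply/finset.bigcupP; exists (counts y) => //.
  rewrite /B; case: pickP => [z /andP[zD /eqP zy]|/(_ y)]; last by rewrite xy eqxx.
  rewrite inE; apply/existsP; exists x; rewrite xs andTb.
  by apply: counts_inj; rewrite zy.
apply: le_trans (ler_prod_unif_perm R sub) _.
rewrite -[N.+1 in leRHS]card_ord -natrX -card_ffun mulr_natl -sumr_const.
rewrite prod_unif_permE.
apply: (@le_trans _ _ (\sum_k #|B k|%:R / N`!%:R ^+ n)).
  rewrite -mulr_suml ler_wpM2r ?invr_ge0 ?exprn_ge0 // -natr_sum ler_nat.
  exact: card_big_setU.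
apply: ler_sum => k _; rewrite -prod_unif_permE /B.
case: pickP => [z /andP[zD _]|_]; first exact: yM.
by rewrite prod_unif_permE cards0 mul0r.
Qed.

(** * Laws of random variables and their marginals *)

Lemma law_comp (R : realType) d (T : measurableType d) (P : probability T R)
  (Y : finType) (A : eqType) (Z : T -> Y) (f : Y -> A) (a : A) :
  (forall b, measurable (Z @^-1` [set b])) ->
  law P (f \o Z) a = \sum_(b | f b == a) law P Z b.
Proof.
move=> mZ; rewrite /law.
have -> : (f \o Z) @^-1` [set a] =
    \bigcup_(b in [set b | f b == a]) Z @^-1` [set b].
  by apply/seteqP; split=> [w /= <-|w [b /= /eqP <- <-]] //; exists (Z w) => /=.
rewrite measure_fin_bigcup //; first last.
- by move=> b b' _ _ [w [/= <- <-]].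
- exact: finite_finset.
rewrite (_ : [set b | _] = [set` [pred b | f b == a]]) //.
rewrite -(bigfs _ (index_enum_uniq Y)) => [|b _]; last by rewrite mem_index_enum.
rewrite sum_fine // => b _; exact: fin_num_measure.
Qed.

Lemma law_ge0 (R : realType) d (T : measurableType d) (P : probability T R)
  (Y : Type) (Z : T -> Y) (y : Y) : 0 <= law P Z y.
Proof. exact: fine_ge0. Qed.

Lemma sum_law (R : realType) d (T : measurableType d) (P : probability T R)
  (Y : finType) (Z : T -> Y) : (forall b, measurable (Z @^-1` [set b])) ->
  \sum_b law P Z b = 1.
Proof.
(* Pushing forward to a one-point type expresses the total mass as the probability of the whole
   space. *)
move=> mZ; have := law_comp P (fun=> tt) tt mZ.
rewrite {1}/law (_ : _ @^-1` _ = setT) ?probability_setT //.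
by apply/seteqP; split.
Qed.

Lemma measurable_joint_rv d (T : measurableType d) (Xs : finType) n
  (X : 'I_n -> T -> Xs) :
  (forall i (B : set Xs), measurable (X i @^-1` B)) ->
  forall b, measurable (joint_rv X @^-1` [set b]).
Proof.
move=> hX b; rewrite (_ : _ @^-1` _ =
  \bigcap_(i in [set: 'I_n]) X i @^-1` [set tnth b i]).
  by apply: fin_bigcap_measurable => // i _; exact: hX.
apply/seteqP; split=> w /= => [<- i _ /=|Xb].
  by rewrite tnth_mktuple.
by apply: eq_from_tnth => i; rewrite tnth_mktuple Xb.
Qed.

Lemma marginal_law (R : realType) d (T : measurableType d) (P : probability T R)
  (Xs : finType) n (X : 'I_n -> T -> Xs) i :
  (forall i (B : set Xs), measurable (X i @^-1` B)) ->
  marginal (law P (joint_rv X)) i = law P (X i).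
Proof.
move=> hX; apply/funext => a; rewrite /marginal.
rewrite -(law_comp P (fun b => tnth b i) a (measurable_joint_rv hX)).
by congr law; apply/funext => w /=; rewrite tnth_mktuple.
Qed.

(** * Two-sided bounds on the rate *)

Lemma ln_negligible (R : realType) (C e : R) : 0 < e ->
  \forall N \near \oo, C * (1 + ln N.+1%:R) <= e * N%:R.
Proof.
move=> e0; pose D : R := `|C| + 1.
have D0 : 0 < D by rewrite ltr_pwDr.
(* With this slope the term of [D * ln (N+1)] linear in N has coefficient [e / 2], which leaves
   [e / 2 * N] to absorb the constants. *)
pose a : R := 2 * D / e; have a0 : 0 < a by rewrite divr_gt0 // mulr_gt0.
near=> N.
have h : ln N.+1%:R <= N.+1%:R / a + ln a by rewrite ln_le_line // ltr0n.
have h0 : 0 <= 1 + ln N.+1%:R :> R by rewrite addr_ge0 // ln_ge0 // ler1n.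
apply: (@le_trans _ _ (D * (1 + ln N.+1%:R))).
  rewrite ler_wpM2r // (le_trans (ler_norm _)) // lerDl //.
apply: (@le_trans _ _ (D * (1 + (N.+1%:R / a + ln a)))).
  by rewrite ler_pM2l // lerD2l.
have -> : D * (1 + (N.+1%:R / a + ln a)) = D * (1 + ln a) + e / 2 * N.+1%:R.
  rewrite /a invf_div; field; rewrite ?gt_eqF //.
rewrite -[N.+1%:R]natr1.
have : (D * (1 + ln a) + e / 2) / (e / 2) <= N%:R.
  by near: N; exact: nbhs_infty_ger.
rewrite ler_pdivrMr ?divr_gt0 //; lra.
Unshelve. all: by end_near. Qed.

(** Half of [e] pays for the variation of [total_correlation] over the window, which fixes [delta];
    the other half pays for the logarithmic errors, which fixes N. A single class gives the lower
    bound, the union bound over types the upper one. *)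
Lemma sym_rate_bounds (R : realType) (Xs : finType) c (t : 'I_c -> Xs) n
  (p : n.-tuple Xs -> R) (e : R) : bijective t ->
  (forall b, 0 <= p b) -> \sum_b p b = 1 -> 0 < e ->
  \forall delta \near 0^'+, \forall N \near \oo,
    ((- total_correlation p - e)%:E <= sym_rate t p delta N
      <= (- total_correlation p + e)%:E)%E.
Proof.
move=> tbij p0 p1 e0; have e20 : 0 < e / 2 by rewrite divr_gt0.
have /cvgrPdist_lt/(_ _ e20) [d0 /= d00 Fp] := cvg_total_correlation p0.
near=> delta.
have delta0 : 0 < delta by [].
have FD N (y : N.-tuple (n.-tuple Xs)) : y \in Delta p N delta ->
    `|total_correlation p - total_correlation (seq_type y)| < e / 2.
  rewrite inE => /forallP yD; apply: Fp => b /=.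
  apply: lt_trans (yD b) _; near: delta; exact: nbhs_right_lt.
(* The factorial error of one class plus the exponent in the bound on the number of types. *)
pose C : R := (sym_const Xs n + #|{: n.-tuple Xs}|)%:R.
near=> N.
have N0 : (0 < N)%N by near: N; exists 1%N.
have NR : 0 < N%:R :> R by rewrite ltr0n.
have [y yD] : exists y : N.-tuple (n.-tuple Xs), y \in Delta p N delta.
  near: N; exact: Delta_neq0.
have CN : C * (1 + ln N.+1%:R) <= e / 2 * N%:R.
  near: N; exact: ln_negligible.
have L0 : 0 <= ln N.+1%:R :> R by rewrite ln_ge0 // ler1n.
set L : R := ln N.+1%:R in CN L0.
set G := total_correlation p.
have {}CN : (sym_const Xs n)%:R * (1 + L) + #|{: n.-tuple Xs}|%:R * (1 + L)
   <= e / 2 * N%:R by rewrite -mulrDl -natrD.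
have Y0 : 0 <= #|{: n.-tuple Xs}|%:R * (1 + L) by rewrite mulr_ge0 // addr_ge0.
have classP (z : N.-tuple (n.-tuple Xs)) : z \in Delta p N delta ->
    `|ln (prod_unif_perm (sym_class t z)) + N%:R * G| <=
    (sym_const Xs n)%:R * (1 + L) + N%:R * (e / 2).
  move=> zD; have := ln_sym_class_approx R z tbij N0; rewrite -/L => h.
  have -> : ln (prod_unif_perm (sym_class t z)) + N%:R * G =
    (ln (prod_unif_perm (sym_class t z)) + N%:R * total_correlation (seq_type z))
    + N%:R * (G - total_correlation (seq_type z)) by ring.
  apply: le_trans (ler_normD _ _) _; rewrite lerD // normrM gtr0_norm //.
  by rewrite ler_pM2l //; apply/ltW/FD.
have [cpos _] := ln_sym_class R y tbij.
have upos : 0 < prod_unif_perm (Delta_sym t p N delta) :> R.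
  by apply: lt_le_trans cpos _; exact/ler_prod_unif_perm/sym_class_sub.
rewrite /sym_rate lne_EFin // -EFinM !lee_fin.
rewrite ler_pdivlMl // ler_pdivrMl //.
apply/andP; split.
  apply: (@le_trans _ _ (ln (prod_unif_perm (sym_class t y)))); last first.
    by rewrite ler_ln ?posrE //; exact/ler_prod_unif_perm/sym_class_sub.
  by have := classP y yD; rewrite ler_norml => /andP[+ _]; lra.
(* The upper half of [classP], common to all classes in the window. *)
pose M : R := expR ((sym_const Xs n)%:R * (1 + L) + N%:R * (e / 2) - N%:R * G).
have uM : prod_unif_perm (Delta_sym t p N delta) <=
    N.+1%:R ^+ #|{: n.-tuple Xs}| * M.
  apply: Delta_sym_le => [|z zD]; first exact: expR_ge0.
  have [zpos _] := ln_sym_class R z tbij.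
  rewrite -[leLHS]lnK ?posrE // ler_expR.
  by have := classP z zD; rewrite ler_norml => /andP[_]; lra.
have Xp : 0 < N.+1%:R ^+ #|{: n.-tuple Xs}| :> R by rewrite exprn_gt0 // ltr0n.
have Mp : 0 < M := expR_gt0 _.
apply: (@le_trans _ _ (ln (N.+1%:R ^+ #|{: n.-tuple Xs}| * M))).
  by rewrite ler_ln ?posrE // mulr_gt0.
rewrite lnM ?posrE // lnXn ?ltr0n // expRK -/L -mulr_natl.
have := ler0n R #|{: n.-tuple Xs}|; move: CN; lra.
Unshelve. all: by end_near. Qed.

(** * Passage to the limits *)

Lemma limn_esup_le (R : realType) (u : (\bar R)^nat) (l : \bar R) :
  (\forall N \near \oo, u N <= l)%E -> (limn_esup u <= l)%E.
Proof.
move=> [K _ ul]; rewrite limn_esup_lim; apply: lime_le.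
  exact: is_cvg_esups.
exists K => // m /= Km; apply: ge_ereal_sup => _ [k /= mk <-].
by apply: ul => /=; exact: leq_trans mk.
Qed.

Lemma limn_einf_ge (R : realType) (u : (\bar R)^nat) (l : \bar R) :
  (\forall N \near \oo, l <= u N)%E -> (l <= limn_einf u)%E.
Proof.
move=> ul; rewrite /limn_einf leeNr; apply: limn_esup_le.
by near=> N; rewrite leeN2; near: N.
Unshelve. all: by end_near. Qed.

(** The bounds with [e = 1] make the values finite, which reduces the claim to convergence of real
    numbers. *)
Lemma cvg_EFin_dist (R : realType) (T : Type) (F : set_system T)
  (f : T -> \bar R) (v : R) : Filter F ->
  (forall e : R, 0 < e -> \forall x \near F, ((v - e)%:E <= f x <= (v + e)%:E)%E) ->
  f x @[x --> F] --> v%:E.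
Proof.
move=> FF fv; apply/fine_cvgP; split.
  near=> x; have /andP[] : ((v - 1)%:E <= f x <= (v + 1)%:E)%E.
    by near: x; exact: fv.
  by case: (f x).
apply/cvgrPdist_le => e e0; near=> x.
have /andP[] : ((v - e)%:E <= f x <= (v + e)%:E)%E by near: x; exact: fv.
rewrite /=; case: (f x) => //= r; rewrite !lee_fin ler_norml => *.
by apply/andP; split; lra.
Unshelve. all: by end_near. Qed.

(** Since liminf is at most limsup, a lower bound on the former and an upper bound on the latter
    squeeze both. *)
Lemma cvg_sym_rate (R : realType) (Xs : finType) c (t : 'I_c -> Xs) n
  (p : n.-tuple Xs -> R) : bijective t ->
  (forall b, 0 <= p b) -> \sum_b p b = 1 ->
  limn_esup (sym_rate t p delta) @[delta --> 0^'+] -->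
    (- total_correlation p)%:E /\
  limn_einf (sym_rate t p delta) @[delta --> 0^'+] -->
    (- total_correlation p)%:E.
Proof.
move=> tbij p0 p1.
have H e : 0 < e -> \forall delta \near (0 : R)^'+,
    ((- total_correlation p - e)%:E <= limn_einf (sym_rate t p delta))%E /\
    (limn_esup (sym_rate t p delta) <= (- total_correlation p + e)%:E)%E.
  move=> e0; near=> delta.
  have : \forall N \near \oo,
    ((- total_correlation p - e)%:E <= sym_rate t p delta N
      <= (- total_correlation p + e)%:E)%E.
    by near: delta; exact: sym_rate_bounds.
  move=> b; split; [apply: limn_einf_ge|apply: limn_esup_le];
    by apply: filterS b => N /andP[].
split; apply: cvg_EFin_dist => e e0; apply: filterS (H e e0) => delta [lo up];
  have h := limn_einf_sup (sym_rate t p delta).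
- by rewrite up (le_trans lo h).
- by rewrite lo (le_trans h up).
Unshelve. all: by end_near. Qed.

Theorem theorem2p5 (R : realType) (disp : measure_display)
  (T : measurableType disp) (P : probability T R)
  (Xs : finType) (d : nat) (t : 'I_d -> Xs) (ht : bijective t)
  (n : nat) (X : 'I_n -> T -> Xs)
  (hX : forall (i : 'I_n) (B : set Xs), measurable (X i @^-1` B)) :
  I_sym P t X = I_sym_bar P t X /\
  I_sym_bar P t X =
    (- entropy (law P (joint_rv X)) + \sum_(i < n) entropy (law P (X i)))%:E.
Proof.
have [supE infE] := cvg_sym_rate ht (law_ge0 P (joint_rv X))
  (sum_law P (measurable_joint_rv hX)).
rewrite /I_sym /I_sym_bar (cvg_lim _ supE) // (cvg_lim _ infE) //.
split=> //; rewrite EFinN oppeK /total_correlation addrC; congr (_ + _)%:E.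
by apply: eq_bigr => i _; rewrite marginal_law.
Qed.
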